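(* Consider the BRIDGE-T algorithm (described in the context) and suppose conditions (A1) (bounded and Lipschitz gradients) and (A4) (sufficient network connectivity) are satisfied. Let $C_w$ be a scalar such that $|[\mathbf w_j(0)]_k|\le C_w$ for all $j\in\mathcal R$ and all $k\in\{1,\dots,d\}$. Define $\mathbf v(t)\in\mathbb R^d$ as the vector whose $k$-th entry is $$[\mathbf v(t)]_k=\sum_{i=1}^{r}[\boldsymbol\alpha_k(0)]_i[\mathbf w_i(0)]_k-\sum_{\tau=0}^{t-1}\rho(\tau)\sum_{i=1}^{r}[\boldsymbol\alpha_k(\tau+1)]_i[\nabla f_i(\mathbf w_i(\tau))]_k ,\qquad k=1,\dots,d .$$ Then the gap between $\mathbf w_j(t)$, for all $j\in\mathcal R$, and $\mathbf v(t)$ goes to $0$ as $t\to\infty$, i.e., $$\lim_{t\to\infty}\max_{j\in\mathcal R}\|\mathbf w_j(t)-\mathbf v(t)\|\le\lim_{t\to\infty}\Big[\sqrt d\,r\,C_w\,\mu^{t/\nu}+\sqrt d\,r\,L\sum_{\tau=0}^{t}\rho(\tau)\,\mu^{(t-\tau+1)/\nu}\Big]=0 .$$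
   Context: **Network.** $\mathcal G(\mathcal J,\mathcal E)$ is a directed, static, connected graph with nodes $\mathcal J=\{1,\dots,M\}$; $\mathcal N_j=\{i\in\mathcal J:(i,j)\in\mathcal E\}$ is the set of nodes that can send messages to $j$. $\mathcal J$ is the disjoint union of the nonfaulty nodes $\mathcal R=\{1,\dots,r\}$ and the Byzantine nodes $\mathcal B$, with $|\mathcal B|\le b$ for a known integer $b$. Every node has at least $2b+1$ neighbors. A *source component* of a graph is any subset of its nodes such that each node in the subset has a directed path to every other node of the graph. A *reduced graph* $\mathcal G_{\rm red}(b)$ of $\mathcal G$ is a subgraph generated from $\mathcal G$ by removing all Byzantine nodes along with all their incoming and outgoing edges, and additionally removing $b$ incoming edges from each nonfaulty node. (A4) All reduced graphs $\mathcal G_{\rm red}(b)$ of $\mathcal G$ contain at least one source component of cardinality at least $b+1$. **Loss.** $f(\mathbf w,\mathbf z)\ge 0$ is a loss function of a model $\mathbf w\in\mathbb R^d$ and a random data sample $\mathbf z$ with law $\mathbb P$. Node $j$ holds $N$ training samples $\mathbf z_{j1},\dots,\mathbf z_{jN}$, and $f_j(\mathbf w)=\frac1N\sum_{n=1}^N f(\mathbf w,\mathbf z_{jn})$. Gradients are with respect to $\mathbf w$; $\|\cdot\|$ is the Euclidean norm; $[\cdot]_k$ is the $k$-th entry. (A1) $f(\cdot,\mathbf z)$ is a.s. differentiable and, a.s., $\|\nabla f(\mathbf w,\mathbf z)\|\le L$ and $\|\nabla f(\mathbf w_1,\mathbf z)-\nabla f(\mathbf w_2,\mathbf z)\|\le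 L'\|\mathbf w_1-\mathbf w_2\|$ for all $\mathbf w,\mathbf w_1,\mathbf w_2\in\mathbb R^d$. **Algorithm BRIDGE-T.** The step sizes $\rho(t)>0$ satisfy $\rho(t+1)\le\rho(t)$, $\rho(t)\to0$, $\sum_t\rho(t)=\infty$, $\sum_t\rho(t)^2<\infty$. Starting from $\mathbf w_j(0)$, $j\in\mathcal R$, at each iteration $t=0,1,2,\dots$ every node $i$ broadcasts a vector $\mathbf w_i(t)\in\mathbb R^d$ (arbitrary if $i\in\mathcal B$). For each $j\in\mathcal R$ and coordinate $k$, let $S^-_{j,k}(t)\subset\mathcal N_j$ (resp. $S^+_{j,k}(t)\subset\mathcal N_j$) be the set of the $b$ neighbors with the smallest (resp. largest) values $[\mathbf w_i(t)]_k$ (ties broken so that the two sets are disjoint), and let $\mathcal C_j^k(t)=\mathcal N_j\setminus(S^-_{j,k}(t)\cup S^+_{j,k}(t))$. Then, with $D_j:=|\mathcal N_j|-2b+1$, $$[\mathbf w_j(t+1)]_k=\frac1{D_j}\sum_{i\in\mathcal C_j^k(t)\cup\{j\}}[\mathbf w_i(t)]_k-\rho(t)[\nabla f_j(\mathbf w_j(t))]_k .$$ **Matrix form over nonfaulty nodes.** For each $k$ the update is expressed as $\boldsymbol\Omega(t+1)=\mathbf Y_k(t)\boldsymbol\Omega(t)-\rho(t)\mathbf g(t)$, where $[\boldsymbol\Omega(t)]_j=[\mathbf w_j(t)]_k$ and $[\mathbf g(t)]_j=[\nabla f_j(\mathbf w_j(t))]_k$ for $j\in\mathcal R$, and the matrix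 $\mathbf Y=\mathbf Y_k(t)\in\mathbb R^{r\times r}$ is as follows (index $t$ suppressed). Let $\mathcal N_j^r=\mathcal N_j\cap\mathcal R$, $\mathcal N_j^b=\mathcal N_j\setminus\mathcal N_j^r$, $b^*=|\mathcal B|$, let $b_j^k$ be the number of Byzantine nodes in $\mathcal C_j^k$, and let $q_j^k=b-b^*+b_j^k\ge0$. - If $q_j^k>0$: choose $m_j'\in S^-_{j,k}\cap\mathcal N_j^r$ and $m_j''\in S^+_{j,k}\cap\mathcal N_j^r$, which satisfy $[\mathbf w_{m_j'}]_k\le[\mathbf w_i]_k\le[\mathbf w_{m_j''}]_k$ for all $i\in\mathcal C_j^k$, and for $i\in\mathcal C_j^k$ let $\theta_i\in(0,1)$ satisfy $[\mathbf w_i]_k=\theta_i[\mathbf w_{m_j'}]_k+(1-\theta_i)[\mathbf w_{m_j''}]_k$. Then $[\mathbf Y]_{ji}=\frac1{2D_j}$ for $i\in\mathcal N_j^r\cap\mathcal C_j^k$; $[\mathbf Y]_{jj}=\frac1{D_j}$; $[\mathbf Y]_{ji}=\sum_{i'\in\mathcal N_j^b\cap\mathcal C_j^k}\frac{\theta_{i'}}{q_j^kD_j}+\sum_{i'\in\mathcal N_j^r\cap\mathcal C_j^k}\frac{\theta_{i'}}{q_j^kD_j}$ for $i\in S^-_{j,k}\cap\mathcal N_j^r$; $[\mathbf Y]_{ji}=\sum_{i'\in\mathcal N_j^b\cap\mathcal C_j^k}\frac{1-\theta_{i'}}{q_j^kD_j}+\sum_{i'\in\mathcal N_j^r\cap\mathcal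 C_j^k}\frac{1-\theta_{i'}}{q_j^kD_j}$ for $i\in S^+_{j,k}\cap\mathcal N_j^r$; and $[\mathbf Y]_{ji}=0$ otherwise. - If $q_j^k=0$: $[\mathbf Y]_{ji}=\frac1{D_j}$ for $i\in\{j\}\cup\mathcal C_j^k$, and $0$ otherwise. Let $\boldsymbol\Phi_k(t,s)=\mathbf Y_k(t)\mathbf Y_k(t-1)\cdots\mathbf Y_k(s)$ for $t\ge s$. Under (A4), by a result of Su and Vaidya, $\lim_{t\to\infty}\boldsymbol\Phi_k(t,s)=\mathbf 1\boldsymbol\alpha_k(s)^T$, where $\boldsymbol\alpha_k(s)\in\mathbb R^r$ has nonnegative entries summing to $1$; this defines $\boldsymbol\alpha_k(s)$. **Constants.** $\psi$ is the total number of reduced graphs that can be generated from $\mathcal G$, $\nu:=\psi r$, $\mathcal N_{\max}:=\max_{j\in\mathcal R}|\mathcal N_j|$, and $\mu:=1-\frac{1}{(2\mathcal N_{\max}-2b+1)^{\nu}}\in(0,1)$.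
   Formalization: The printed Y can have row sums above 1, so α may not exist. The theorem covers the printed Y when the matrix form and stochastic limits hold, and, with nothing assumed, a corrected Y (halved nonfaulty weights, new normalization, θ and q). θ may lie in [0,1]. *)

(* Defs.v *)
(* MathComp / MathComp-Analysis *)
From HB Require Import structures.
From mathcomp Require Import all_boot all_order all_algebra.
From mathcomp Require Import all_classical all_reals all_analysis.
Set Implicit Arguments.
Unset Strict Implicit.
Unset Printing Implicit Defensive.
Import Order.TTheory GRing.Theory Num.Theory.
Import numFieldNormedType.Exports.
Local Open Scope classical_set_scope.
Local Open Scope ring_scope.

(* The library norm on 'rV[R]_d is the sup norm. *)
Definition enorm (R : realType) (d : nat) (u : 'rV[R]_d) : R :=
  Num.sqrt (\sum_(k < d) u 0 k ^+ 2).

Definition grad (R : realType) (d : nat) (f : 'rV[R]_d -> R) (u : 'rV[R]_d) :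
    'rV[R]_d :=
  \row_(k < d) 'D_(delta_mx 0 k) f u.

(* The nodes are 'I_(r + nb): the nonfaulty ones are [lshift nb j], j : 'I_r,
   and the Byzantine ones are [rshift r i], i : 'I_nb; [e i j] means that i can
   send messages to j. *)
Section Network.
Variables (r nb : nat) (e : rel 'I_(r + nb)) (b : nat).

Definition nonfaulty : {set 'I_(r + nb)} := [set lshift nb j | j : 'I_r]%SET.
Definition byzantine : {set 'I_(r + nb)} := [set rshift r i | i : 'I_nb]%SET.

Definition nbrs (j : 'I_(r + nb)) : {set 'I_(r + nb)} := [set i | e i j]%SET.

Definition nonfaulty_edges : {set 'I_r * 'I_r} :=
  [set p | e (lshift nb p.1) (lshift nb p.2)]%SET.

(* A reduced graph is represented by its set of edges. *)
Definition reduced_graph (H : {set 'I_r * 'I_r}) : bool :=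
  (H \subset nonfaulty_edges) &&
  [forall j : 'I_r, #|[set i | (i, j) \in nonfaulty_edges :\: H]%SET| == b].

Definition source_component (H : {set 'I_r * 'I_r}) (S : {set 'I_r}) : Prop :=
  forall i, i \in S -> forall j, connect (fun u v => (u, v) \in H) i j.

Definition A4 : Prop :=
  forall H, reduced_graph H ->
    exists S : {set 'I_r}, (b + 1 <= #|S|)%N /\ source_component H S.

Definition nb_reduced_graphs : nat := #|[set H | reduced_graph H]%SET|.

Definition nu : nat := (nb_reduced_graphs * r)%N.

Definition Nmax : nat := (\max_(j < r) #|nbrs (lshift nb j)|)%N.

Definition mu (R : realType) : R :=
  1 - ((2 * Nmax - 2 * b + 1)%N%:R ^+ nu)^-1.

Definition Dj (j : 'I_r) : nat := (#|nbrs (lshift nb j)| - 2 * b + 1)%N.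

Definition weakly_connected : Prop :=
  forall i j, connect (fun u v => e u v || e v u) i j.

End Network.

Definition A1 (R : realType) (dZ : measure_display) (Z : measurableType dZ)
    (PZ : probability Z R) (d : nat) (f : 'rV[R]_d -> Z -> R) (L L' : R) : Prop :=
  {ae PZ, forall z,
    [/\ forall u, differentiable (fun w => f w z) u,
        forall u, enorm (grad (fun w => f w z) u) <= L
      & forall u1 u2,
          enorm (grad (fun w => f w z) u1 - grad (fun w => f w z) u2)
            <= L' * enorm (u1 - u2)]}.

Definition local_loss (R : realType) (Z : Type) (d N : nat)
    (f : 'rV[R]_d -> Z -> R) (z : 'I_N -> Z) (u : 'rV[R]_d) : R :=
  N%:R^-1 * \sum_(n < N) f u (z n).

Definition step_sizes (R : realType) (rho : nat -> R) : Prop :=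
  [/\ forall t, 0 < rho t,
      forall t, rho t.+1 <= rho t,
      rho t @[t --> \oo] --> (0 : R),
      (\sum_(0 <= u < t) rho u) @[t --> \oo] --> +oo
    & cvg ((\sum_(0 <= u < t) rho u ^+ 2) @[t --> \oo])].

(* One coordinate of one nonfaulty node j at one iteration: [x i] is the value
   [w_i(t)]_k, and [Sm], [Sp] are the sets of trimmed neighbours. *)
Section Coordinate.
Variables (R : realType) (r nb : nat) (e : rel 'I_(r + nb)) (b : nat).
Variables (x : 'I_(r + nb) -> R) (j : 'I_r) (Sm Sp : {set 'I_(r + nb)}).

Let Nj := nbrs e (lshift nb j).
Let D : R := (Dj e b j)%:R.

Definition trimming : Prop :=
  [/\ Sm \subset Nj /\ Sp \subset Nj,
      #|Sm| = b /\ #|Sp| = b,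
      [disjoint Sm & Sp]%B,
      forall i i', i \in Sm -> i' \in Nj :\: Sm -> x i <= x i'
    & forall i i', i \in Sp -> i' \in Nj :\: Sp -> x i' <= x i].

Definition kept : {set 'I_(r + nb)} := Nj :\: (Sm :|: Sp).

Definition trimmed_mean : R := D^-1 * \sum_(i in lshift nb j |: kept) x i.

Let C := kept.
Let Cb := C :&: byzantine r nb.
Let Cr := C :&: nonfaulty r nb.
Let Smr := Sm :&: nonfaulty r nb.
Let Spr := Sp :&: nonfaulty r nb.

Definition literal_row (y : 'I_r -> R) : Prop :=
  let q := (b - nb + #|Cb|)%N in
  if (0 < q)%N then
    exists m' m'' (theta : 'I_(r + nb) -> R),
    [/\ m' \in Smr, m'' \in Spr,
        forall i, i \in C -> x m' <= x i <= x m'',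
        forall i, i \in C ->
          0 <= theta i <= 1 /\ x i = theta i * x m' + (1 - theta i) * x m''
      & forall i : 'I_r, y i =
          if i == j then D^-1
          else if lshift nb i \in Cr then (2 * D)^-1
          else if lshift nb i \in Smr then
            \sum_(i' in Cb) theta i' / (q%:R * D)
              + \sum_(i' in Cr) theta i' / (q%:R * D)
          else if lshift nb i \in Spr then
            \sum_(i' in Cb) (1 - theta i') / (q%:R * D)
              + \sum_(i' in Cr) (1 - theta i') / (q%:R * D)
          else 0]
  else
    forall i : 'I_r, y i =
      if (i == j) || (lshift nb i \in C) then D^-1 else 0.

Definition mean_over (A : {set 'I_(r + nb)}) : R := #|A|%:R^-1 * \sum_(i in A) x i.

(* [literal_row] sums to 1 and returns the trimmed mean only in special cases.
   If 0 < q, a summand theta i' for i' in Cr duplicates half of the weight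
   already put on i', the sets Smr and Spr may have more than q elements, and
   theta interpolates between the values at m' and m'' although the weight is
   spread over all of Smr and Spr.  If q = 0 but some Byzantine nodes are not
   neighbours of j, more than b nonfaulty neighbours get weight 0, so that the
   condition on reduced graphs does not apply.  Here only the Byzantine
   neighbours are counted in q, the duplicated weight is halved, the
   normalization is by #|Smr| and #|Spr|, and theta interpolates between the
   means over Smr and Spr; the row is then stochastic and returns the trimmed
   mean. *)
Definition normalized_row (y : 'I_r -> R) : Prop :=
  let q := (b - #|Nj :&: byzantine r nb| + #|Cb|)%N in
  if (0 < q)%N then
    exists theta : 'I_(r + nb) -> R,
    [/\ forall i, i \in C ->
          0 <= theta i <= 1 /\
          x i = theta i * mean_over Smr + (1 - theta i) * mean_over Spr
      & forall i : 'I_r, y i =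
          if i == j then D^-1
          else if lshift nb i \in Cr then (2 * D)^-1
          else if lshift nb i \in Smr then
            \sum_(i' in Cb) theta i' / (#|Smr|%:R * D)
              + \sum_(i' in Cr) theta i' / (2 * #|Smr|%:R * D)
          else if lshift nb i \in Spr then
            \sum_(i' in Cb) (1 - theta i') / (#|Spr|%:R * D)
              + \sum_(i' in Cr) (1 - theta i') / (2 * #|Spr|%:R * D)
          else 0]
  else
    forall i : 'I_r, y i =
      if (i == j) || (lshift nb i \in C) then D^-1 else 0.

End Coordinate.

(* Y(t) Y(t-1) ... Y(s), meant for s <= t. *)
Definition Phi (R : realType) (r : nat) (Y : nat -> 'M[R]_r) (t s : nat) : 'M[R]_r :=
  \prod_(0 <= u < (t - s).+1) Y (t - u)%N.

Definition is_limit_weights (R : realType) (r : nat) (Y : nat -> 'M[R]_r) (s : nat)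
    (a : 'I_r -> R) : Prop :=
  [/\ forall i, 0 <= a i, \sum_(i < r) a i = 1
    & forall j i, Phi Y t s j i @[t --> \oo] --> a i].

(* The only [a] such that [is_limit_weights Y s a], if there is one. *)
Definition alpha (R : realType) (r : nat) (Y : nat -> 'M[R]_r) (s : nat) : 'I_r -> R :=
  xget (fun=> 0) [set a | is_limit_weights Y s a].

Section Algorithm.
Variables (R : realType) (r nb : nat) (e : rel 'I_(r + nb)) (b d : nat).
(* [F j] is the local loss of the nonfaulty node j, and [w t i] is the vector
   broadcast at iteration t by node i, Byzantine or not. *)
Variables (F : 'I_r -> 'rV[R]_d -> R) (rho : nat -> R).
Variable w : nat -> 'I_(r + nb) -> 'rV[R]_d.
Variables Sm Sp : nat -> 'I_r -> 'I_d -> {set 'I_(r + nb)}.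
Variable Y : 'I_d -> nat -> 'M[R]_r.

Definition bridge_t : Prop :=
  forall t (j : 'I_r) (k : 'I_d),
    trimming e b (fun i => w t i 0 k) j (Sm t j k) (Sp t j k) /\
    w t.+1 (lshift nb j) 0 k =
      trimmed_mean e b (fun i => w t i 0 k) j (Sm t j k) (Sp t j k)
        - rho t * grad (F j) (w t (lshift nb j)) 0 k.

Definition matrix_form : Prop :=
  forall (k : 'I_d) t,
    (\col_(j < r) w t.+1 (lshift nb j) 0 k) =
      Y k t *m (\col_(j < r) w t (lshift nb j) 0 k)
        - rho t *: (\col_(j < r) grad (F j) (w t (lshift nb j)) 0 k).

(* Since a literal family need not represent the update nor have convergent
   products, these two properties are part of the first alternative; they hold
   automatically in the second one. *)
Definition mixing_matrices : Prop :=
  [/\ forall k t j,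
        literal_row e b (fun i => w t i 0 k) j (Sm t j k) (Sp t j k) (Y k t j),
      matrix_form
    & forall k s, exists a, is_limit_weights (Y k) s a]
  \/
  forall k t j,
    normalized_row e b (fun i => w t i 0 k) j (Sm t j k) (Sp t j k) (Y k t j).

Definition v (t : nat) : 'rV[R]_d :=
  \row_(k < d)
    (\sum_(i < r) alpha (Y k) 0 i * w 0%N (lshift nb i) 0 k
     - \sum_(0 <= u < t)
         rho u * \sum_(i < r)
                   alpha (Y k) u.+1 i * grad (F i) (w u (lshift nb i)) 0 k).

Definition gap (t : nat) : R :=
  \big[Num.max/0]_(j < r) enorm (w t (lshift nb j) - v t).

Definition gap_bound (Cw L : R) (t : nat) : R :=
  Num.sqrt d%:R * r%:R * Cw * mu e b R `^ (t%:R / (nu e b)%:R)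
  + Num.sqrt d%:R * r%:R * L *
      \sum_(0 <= u < t.+1)
        rho u * mu e b R `^ ((t - u + 1)%N%:R / (nu e b)%:R).

End Algorithm.

(* Main.v *)
(** Since alpha_k(s)^T = alpha_k(s+1)^T Y_k(s), the vector v(t) is exactly the
    alpha_k(t)-weighted mean of the w_i(t), so the gap is at most the oscillation
    of the w_i(t) over the nonfaulty nodes. That oscillation tends to 0 whatever
    the given matrices are: the trimmed mean is always represented by some
    normalized stochastic matrix whose positive entries contain a reduced graph.
    By (A4) this graph has a root, so the supports of two rows of a backward
    product grow until they meet, and r consecutive matrices contract the
    oscillation by a fixed factor, while the gradient terms add only O(rho(t)). *)

Require Import Defs.
From HB Require Import structures.
From mathcomp Require Import all_boot all_order all_algebra.
From mathcomp Require Import all_classical all_reals all_analysis.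
From mathcomp Require Import ring lra zify.
Set Implicit Arguments.
Unset Strict Implicit.
Unset Printing Implicit Defensive.
Import Order.TTheory GRing.Theory Num.Theory.
Import numFieldNormedType.Exports.
Local Open Scope classical_set_scope.
Local Open Scope ring_scope.

(** As soon as [u] stays below [eps / 2 * (1 - c)], the recursion is dominated by an affine map with
    slope [c] and fixed point [eps / 2]. The excess of [a] over [eps / 2] therefore shrinks by the
    factor [c] every [p] steps. *)
Lemma cvg0_delayed_contraction (R : realType) (a u : nat -> R) (c : R) (p : nat) :
  (0 < p)%N -> 0 <= c < 1 -> (forall t, 0 <= a t) ->
  (forall t, a (t + p)%N <= c * a t + u t) ->
  u t @[t --> \oo] --> (0 : R) -> a t @[t --> \oo] --> (0 : R).
Proof.
move=> p0 /andP[c0 c1] a0 ha /cvgr0Pnorm_le hu; apply/cvgr0Pnorm_le => eps eps0.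
have e2 : 0 < eps / 2 * (1 - c) by rewrite mulr_gt0 ?subr_gt0 ?divr_gt0.
have [T _ hT] := hu _ e2.
(* Every later index is reached by jumps of length [p] from one of these [p] consecutive ones, so
   [B] bounds the initial excess in all residue classes at once. *)
pose B := \sum_(s < p) a (T + s)%N.
have step t : (T + p <= t)%N -> a t <= c * a (t - p)%N + eps / 2 * (1 - c).
  move=> tp; have := ha (t - p)%N; rewrite subnK; last by lia.
  move=> /le_trans; apply; rewrite lerD2l; apply: le_trans (ler_norm _) _.
  by apply: hT => /=; lia.
have B0 : 0 <= B by apply: sumr_ge0.
have bnd n : forall t, (T + n * p <= t)%N -> a t <= eps / 2 + c ^+ n * B.
  elim: n => [|n IH] t tn.
    rewrite expr0 mul1r; elim/ltn_ind: t tn => t IH tn.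
    have [tp|tp] := leqP (T + p) t.
      have /IH H : (t - p < t)%N by lia.
      have {H} : a (t - p)%N <= eps / 2 + B by apply: H; lia.
      have := step _ tp; nra.
    have tTp : (t - T < p)%N by lia.
    have : a t <= B.
      rewrite /B (bigD1 (Ordinal tTp)) //= subnKC ?lerDl; last by lia.
      by apply: sumr_ge0.
    by lra.
  have tp : (T + p <= t)%N by lia.
  have H : a (t - p)%N <= eps / 2 + c ^+ n * B by apply: IH; lia.
  by have := step _ tp; rewrite exprS; nra.
have /cvgr0Pnorm_le hc : (c ^+ n * B) @[n --> \oo] --> (0 : R).
  rewrite -[X in _ --> X](mul0r B); apply: cvgM; last exact: cvg_cst.
  by apply: cvg_expr; rewrite ger0_norm.
have e3 : 0 < eps / 2 by rewrite divr_gt0.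
have [n0 _ hn0] := hc _ e3.
exists (T + n0 * p)%N => //= t tn.
have := hn0 n0 (leqnn _); rewrite /= ger0_norm ?mulr_ge0 ?exprn_ge0 // => h.
by rewrite ger0_norm //; have := bnd _ _ tn; lra.
Qed.

(** * Stochastic matrices and the oscillation of a vector *)

Section StochasticMatrices.
Variables (R : realType) (r : nat).
Implicit Types (x : 'cV[R]_r) (P Q : 'M[R]_r).

Definition osc x : R :=
  \big[Num.max/0]_(i < r) \big[Num.max/0]_(j < r) (x i 0 - x j 0).

Lemma osc_ge0 x : 0 <= osc x.
Proof. exact: bigmax_ge_id. Qed.

Lemma le_osc x i j : x i 0 - x j 0 <= osc x.
Proof.
apply: le_trans (le_bigmax _ _ i).
exact: (le_bigmax _ (fun j => x i 0 - x j 0) j).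
Qed.

Lemma osc_le x D : 0 <= D -> (forall i j, x i 0 - x j 0 <= D) -> osc x <= D.
Proof. by move=> D0 h; apply: bigmax_le => // i _; apply: bigmax_le. Qed.

Lemma oscD_le x (y : 'cV[R]_r) D :
  0 <= D -> (forall i, `|y i 0| <= D) -> osc (x + y) <= osc x + 2 * D.
Proof.
move=> D0 h; apply: osc_le => [|i j]; first by rewrite addr_ge0 ?osc_ge0 ?mulr_ge0.
rewrite !mxE; have := le_osc x i j; have := h i; have := h j.
by rewrite !ler_norml => /andP[? ?] /andP[? ?]; lra.
Qed.

Definition stochastic P : Prop :=
  (forall i j, 0 <= P i j) /\ forall i, \sum_j P i j = 1.

Lemma stochastic1 : stochastic 1%:M.
Proof.
split=> [i j|i]; first by rewrite mxE ler0n.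
by rewrite (bigD1 i) //= mxE eqxx big1 ?addr0 // => j /negPf ji; rewrite mxE eq_sym ji.
Qed.

Lemma stochastic_mul P Q : stochastic P -> stochastic Q -> stochastic (P *m Q).
Proof.
move=> [P0 P1] [Q0 Q1]; split=> [i j|i].
  by rewrite mxE; apply: sumr_ge0 => k _; rewrite mulr_ge0.
under eq_bigr do rewrite mxE.
rewrite exchange_big /= -[RHS](P1 i); apply: eq_bigr => k _.
by rewrite -mulr_sumr Q1 mulr1.
Qed.

Lemma stochastic_mulmx_le P x M i :
  stochastic P -> (forall j, x j 0 <= M) -> (P *m x) i 0 <= M.
Proof.
move=> [P0 P1] xM; rewrite mxE -[M]mul1r -(P1 i) mulr_suml.
by apply: ler_sum => j _; rewrite ler_wpM2l.
Qed.

Lemma stochastic_mulmx_ge P x M i :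
  stochastic P -> (forall j, M <= x j 0) -> M <= (P *m x) i 0.
Proof.
move=> [P0 P1] xM; rewrite mxE -[M]mul1r -(P1 i) mulr_suml.
by apply: ler_sum => j _; rewrite ler_wpM2l.
Qed.

Lemma stochastic_mulmx_norm P x M i :
  stochastic P -> (forall j, `|x j 0| <= M) -> `|(P *m x) i 0| <= M.
Proof.
move=> sP xM; rewrite ler_norml; apply/andP; split.
  by apply: stochastic_mulmx_ge => // j; move: (xM j); rewrite ler_norml => /andP[].
by apply: stochastic_mulmx_le => // j; move: (xM j); rewrite ler_norml => /andP[].
Qed.

(** A quantitative form of the scrambling condition for Markov chains; for a stochastic matrix it
    bounds the Dobrushin contraction coefficient by [1 - delta]. *)
Definition scrambling (delta : R) P : Prop :=
  forall i j, exists k, delta <= P i k /\ delta <= P j k.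

(** Let [x] be largest at [M] and smallest at [m], and let [k] be a column shared by rows [i] and
    [j]. The weight on [x k] pulls row [i] down from [x M] by at least [delta * (x M - x k)] and row
    [j] up from [x m] by at least [delta * (x k - x m)]. The two amounts add up to
    [delta * (x M - x m)]. *)
Lemma osc_scrambling_le delta P x : 0 <= delta <= 1 -> stochastic P ->
  scrambling delta P -> osc (P *m x) <= (1 - delta) * osc x.
Proof.
move=> /andP[d0 d1] [P0 P1] hP.
apply: osc_le => [|i j]; first by rewrite mulr_ge0 ?osc_ge0 // subr_ge0.
have [k [ik jk]] := hP i j.
case: (@arg_maxP _ _ _ i predT (fun l => x l 0) isT) => M _ hM.
case: (@arg_minP _ _ _ i predT (fun l => x l 0) isT) => m _ hm.
have lo l : 0 <= x l 0 - x m 0 by rewrite subr_ge0; apply: hm.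
have up l : 0 <= x M 0 - x l 0 by rewrite subr_ge0; apply: hM.
have Mi : x M 0 - (P *m x) i 0 = \sum_l P i l * (x M 0 - x l 0).
  by under eq_bigr do rewrite mulrBr; rewrite sumrB -mulr_suml P1 mul1r mxE.
have mj : (P *m x) j 0 - x m 0 = \sum_l P j l * (x l 0 - x m 0).
  by under eq_bigr do rewrite mulrBr; rewrite sumrB -mulr_suml P1 mul1r mxE.
have hi : delta * (x M 0 - x k 0) <= x M 0 - (P *m x) i 0.
  rewrite Mi (bigD1 k) //= ler_wpDr //; last by rewrite ler_wpM2r.
  by apply: sumr_ge0 => l _; rewrite mulr_ge0.
have hj : delta * (x k 0 - x m 0) <= (P *m x) j 0 - x m 0.
  rewrite mj (bigD1 k) //= ler_wpDr //; last by rewrite ler_wpM2r.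
  by apply: sumr_ge0 => l _; rewrite mulr_ge0.
by have := le_osc x M m; nra.
Qed.

End StochasticMatrices.

(** * Backward products of rooted stochastic matrices *)

Lemma connect_enters (T : finType) (g : rel T) (A : {set T}) (i j : T) :
  connect g i j -> i \notin A -> j \in A ->
  exists u v, [/\ g u v, u \notin A & v \in A].
Proof.
move=> /connectP[p]; elim: p i => [|k p IH] i /=.
  by move=> _ -> /negP.
move=> /andP[ik kp] jE iA jA; have [kA|kA] := boolP (k \in A).
  by exists i, k.
exact: IH kp jE kA jA.
Qed.

Section Products.
Variables (R : realType) (r : nat) (beta : R) (Y : nat -> 'M[R]_r).

(* [fprod s n] is [Y (s + n - 1) ... Y s]; unlike [Phi], it can be empty. *)
Fixpoint fprod (s n : nat) : 'M[R]_r :=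
  if n is m.+1 then Y (s + m) *m fprod s m else 1%:M.

Lemma Phi_fprod s n : Phi Y (s + n) s = fprod s n.+1.
Proof.
rewrite /Phi addKn; elim: n => [|n IH].
  by rewrite big_nat1 /= subn0 addn0 mulmx1.
rewrite big_nat_recl // subn0 -[RHS]/(Y (s + n.+1)%N *m fprod s n.+1) -IH.
congr (_ * _).
by apply: eq_bigr => u _; rewrite addnS subSS.
Qed.

Lemma fprod_stochastic s n : (forall t, stochastic (Y t)) -> stochastic (fprod s n).
Proof.
move=> sY; elim: n => [|n IH] /=; first exact: stochastic1.
exact: stochastic_mul.
Qed.

(** Row [v] holds the weights of what node [v] receives, so an edge from [u] to [v] is read off
    [P v u]. The diagonal bound keeps the support of a row from shrinking when a factor is added. *)
Definition rooted (P : 'M[R]_r) : Prop :=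
  (forall i, beta <= P i i) /\
  exists i0, forall j, connect (fun u v => beta <= P v u) i0 j.

Hypothesis beta0 : 0 <= beta.
Hypothesis sY : forall t, stochastic (Y t).
Hypothesis rY : forall t, rooted (Y t).

(* [A] and [B] are parts of the supports of two rows of a product ending with
   [Y (s + n - 1) ... Y s]; each factor adds a point to one of them as long as
   they are disjoint, since the root lies outside one of them. *)
Lemma fprod_meet s n (A B : {set 'I_r}) (gamma : R) (p q : 'rV[R]_r) :
  0 <= gamma -> (forall k, 0 <= p 0 k) -> (forall k, 0 <= q 0 k) ->
  (forall k, k \in A -> gamma <= p 0 k) -> (forall k, k \in B -> gamma <= q 0 k) ->
  A != finset.set0 -> B != finset.set0 ->
  ~~ [disjoint A & B]%B || (r < #|A| + #|B| + n)%N ->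
  exists k, gamma * beta ^+ n <= (p *m fprod s n) 0 k /\
            gamma * beta ^+ n <= (q *m fprod s n) 0 k.
Proof.
elim: n A B gamma p q => [|n IH] A B gamma p q g0 p0 q0 pA qB A0 B0 AB.
  (* With no factor left, disjoint [A] and [B] would have more than [r] elements together. *)
  rewrite expr0 mulr1 /= !mulmx1.
  have [dAB|] := boolP [disjoint A & B]%B.
    move: AB; rewrite dAB /= addn0 ltnNge.
    have /eqP <- : #|A :|: B|%SET == (#|A| + #|B|)%N by rewrite (leq_card_setU A B).
    by rewrite -[leqRHS]card_ord max_card.
  move=> /pred0Pn[k /= /andP[kA kB]].
  by exists k; split; [exact: pA | exact: qB].
have nneg (u : 'rV[R]_r) : (forall k, 0 <= u 0 k) ->
    forall k, 0 <= (u *m Y (s + n)) 0 k.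
  by move=> u0 k; rewrite mxE; apply: sumr_ge0 => l _; rewrite mulr_ge0 // (sY _).1.
have move1 (u : 'rV[R]_r) l k : (forall k, 0 <= u 0 k) -> gamma <= u 0 l ->
    beta <= Y (s + n) l k -> gamma * beta <= (u *m Y (s + n)) 0 k.
  move=> u0 ul Ylk; rewrite mxE (bigD1 l) //= ler_wpDr ?ler_pM //.
  by apply: sumr_ge0 => m _; rewrite mulr_ge0 // (sY _).1.
rewrite /= !mulmxA exprS mulrA.
have [diag [i0 root]] := rY (s + n).
have g1 : 0 <= gamma * beta by rewrite mulr_ge0.
have pA1 k : k \in A -> gamma * beta <= (p *m Y (s + n)) 0 k.
  by move=> kA; apply: move1 (diag k) => //; exact: pA.
have qB1 k : k \in B -> gamma * beta <= (q *m Y (s + n)) 0 k.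
  by move=> kB; apply: move1 (diag k) => //; exact: qB.
have [dAB|] := boolP [disjoint A & B]%B; last first.
  by move=> mAB; apply: (IH A B); rewrite ?mAB //; exact: nneg.
move: AB; rewrite dAB /= addnS => cAB.
(* A path from the root into the set that misses it has an edge from some [k] outside to some [l]
   inside. The factor [Y (s + n)] carries weight from column [l] to column [k], so [k] joins that
   set. *)
have [iA|iA] := boolP (i0 \in A).
  have iB : i0 \notin B by rewrite (disjointFr dAB iA).
  have /set0Pn[j jB] := B0.
  have [k [l [Ylk kB lB]]] := connect_enters (root j) iB jB.
  apply: (IH A (k |: B)%SET) => //; try exact: nneg.
  - move=> m /setU1P[->|]; last exact: qB1.
    by apply: move1 Ylk => //; exact: qB.
  - by apply/set0Pn; exists k; rewrite setU11.
  - by rewrite cardsU1 kB add1n addnS addSn cAB orbT.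
have /set0Pn[j jA] := A0.
have [k [l [Ylk kA lA]]] := connect_enters (root j) iA jA.
apply: (IH (k |: A)%SET B) => //; try exact: nneg.
- move=> m /setU1P[->|]; last exact: pA1.
  by apply: move1 Ylk => //; exact: pA.
- by apply/set0Pn; exists k; rewrite setU11.
- by rewrite cardsU1 kA add1n !addSn cAB orbT.
Qed.

(** The supports start as the singletons of [i] and [j]; [r] factors suffice since [1 + 1 + r]
    exceeds [r]. *)
Lemma fprod_scrambling s : scrambling (beta ^+ r) (fprod s r).
Proof.
move=> i j.
have nneg (l k : 'I_r) : 0 <= (delta_mx 0 l : 'rV[R]_r) 0 k by rewrite mxE ler0n.
have one (l k : 'I_r) : k \in [set l]%SET -> 1 <= (delta_mx 0 l : 'rV[R]_r) 0 k.
  by move=> /set1P ->; rewrite mxE !eqxx.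
have ne (l : 'I_r) : [set l]%SET != finset.set0 by apply/set0Pn; exists l; exact: set11.
have [|k] := fprod_meet s (n := r) ler01 (nneg i) (nneg j) (one i) (one j) (ne i) (ne j).
  by rewrite !cards1 (_ : (r < 1 + 1 + r)%N) ?orbT //; lia.
by rewrite mul1r -!rowE !mxE => h; exists k.
Qed.

End Products.

(** * Consensus under vanishing perturbations, and existence of the limit weights *)

Lemma cvgr_sum (R : realType) (T I : Type) (F : set_system T) {FF : Filter F}
    (r : seq I) (f : I -> T -> R) (a : I -> R) :
  (forall i, f i x @[x --> F] --> a i) ->
  (\sum_(i <- r) f i x) @[x --> F] --> \sum_(i <- r) a i.
Proof.
move=> fa; elim: r => [|i r IH].
  by rewrite big_nil; under eq_cvg do rewrite big_nil; exact: cvg_cst.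
by rewrite big_cons; under eq_cvg do rewrite big_cons; exact: cvgD.
Qed.

Section Consensus.
Variables (R : realType) (r : nat) (beta : R).
Hypotheses (r0 : (0 < r)%N) (beta0 : 0 < beta).

Lemma rooted_le1 (P : 'M[R]_r) : stochastic P -> rooted beta P -> beta <= 1.
Proof.
move=> [P0 P1] [diag _]; pose i := Ordinal r0; apply: le_trans (diag i) _.
by rewrite -(P1 i) (bigD1 i) //= lerDl; apply: sumr_ge0.
Qed.

(** Over [r] consecutive steps the linear part is a scrambling product. The perturbations add at
    most [r%:R * (rho t * L)] to each entry, since [rho] is nonincreasing and stochastic matrices do
    not enlarge a bound on the entries. This is a contraction with delay [r] and a vanishing
    error. *)
Lemma osc_cvg0 (Y : nat -> 'M[R]_r) (rho : nat -> R) (L : R) (X G : nat -> 'cV[R]_r) :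
  (forall t, stochastic (Y t)) -> (forall t, rooted beta (Y t)) ->
  (forall t, 0 <= rho t) -> (forall t, rho t.+1 <= rho t) ->
  rho t @[t --> \oo] --> (0 : R) ->
  (forall t j, `|G t j 0| <= L) ->
  (forall t, X t.+1 = Y t *m X t - rho t *: G t) ->
  osc (X t) @[t --> \oo] --> (0 : R).
Proof.
move=> sY rY rho0 rho_dec rho_cvg GL hX.
have L0 : 0 <= L := le_trans (normr_ge0 _) (GL 0%N (Ordinal r0)).
have rho_le t n : rho (t + n)%N <= rho t.
  elim: n => [|n IH]; first by rewrite addn0.
  by rewrite addnS; exact: le_trans (rho_dec _) IH.
have E t n : exists Z : 'cV[R]_r, X (t + n)%N = fprod Y t n *m X t + Z /\
    forall j, `|Z j 0| <= n%:R * (rho t * L).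
  elim: n => [|n [Z [IH HZ]]].
    by exists 0; rewrite addn0 /= mul1mx addr0; split=> // j; rewrite mxE normr0 mul0r.
  exists (Y (t + n)%N *m Z - rho (t + n)%N *: G (t + n)%N); split.
    by rewrite addnS hX IH /= mulmxDr mulmxA addrA.
  move=> j; rewrite -natr1 mulrDl mul1r.
  have -> : (Y (t + n)%N *m Z - rho (t + n)%N *: G (t + n)%N) j 0 =
    (Y (t + n)%N *m Z) j 0 - rho (t + n)%N * G (t + n)%N j 0 by rewrite !mxE.
  apply: le_trans (ler_normB _ _) _; apply: lerD.
    exact: stochastic_mulmx_norm.
  by rewrite normrM ger0_norm // ler_pM.
have b01 : 0 <= beta ^+ r <= 1.
  by rewrite exprn_ge0 ?exprn_ile1 ?(rooted_le1 (sY 0%N) (rY 0%N)) // ltW.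
(* The factor 2 allows the perturbation to raise one entry and lower another. *)
apply: (@cvg0_delayed_contraction _ _ (fun t => 2 * (r%:R * (rho t * L)))
  (1 - beta ^+ r) r) => //.
- by rewrite subr_ge0 (andP b01).2 ltrBlDr ltrDl exprn_gt0.
- by move=> t; exact: osc_ge0.
- move=> t; have [Z [-> HZ]] := E t r.
  apply: le_trans (oscD_le _ _ HZ) _; first by rewrite !mulr_ge0.
  rewrite lerD2r; apply: osc_scrambling_le => //; first exact: fprod_stochastic.
  by apply: fprod_scrambling => //; exact: ltW.
- have : (rho t * (2 * r%:R * L)) @[t --> \oo] --> 0 * (2 * r%:R * L).
    by apply: cvgM => //; exact: cvg_cst.
  rewrite mul0r; apply: cvg_trans; apply: near_eq_cvg; apply: nearW => t.
  by rewrite /=; ring.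
Qed.

(** Each column of the product follows the recursion without perturbation, so its oscillation tends
    to 0. Its smallest entry is nondecreasing, because new entries are convex combinations of old
    ones, and it is at most 1. Hence all entries of a column share one limit. *)
Lemma limit_weights_exist (Y : nat -> 'M[R]_r) (s : nat) :
  (forall t, stochastic (Y t)) -> (forall t, rooted beta (Y t)) ->
  exists a, is_limit_weights Y s a.
Proof.
move=> sY rY; have sF n : stochastic (fprod Y s n) by exact: fprod_stochastic.
have F1 n j i : fprod Y s n j i <= 1.
  rewrite -((sF n).2 j) (bigD1 i) //= lerDl; apply: sumr_ge0 => k _; exact: (sF n).1.
have colF n j i : col i (fprod Y s n) j 0 = fprod Y s n j i by rewrite mxE.
have colS n i : col i (fprod Y s n.+1) = Y (s + n)%N *m col i (fprod Y s n).
  by rewrite /= !matrix.colE mulmxA.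
have osc0 i : osc (col i (fprod Y s n)) @[n --> \oo] --> (0 : R).
  apply: (@osc_cvg0 (fun n => Y (s + n)%N) (fun=> 0) 0 _ (fun=> 0)) => //.
  - exact: cvg_cst.
  - by move=> t j; rewrite mxE normr0.
  - by move=> t; rewrite scaler0 subr0 colS.
(* The default value 1 is harmless, as no entry exceeds 1. *)
pose m i n := \big[Num.min/1]_(j < r) fprod Y s n j i.
have m_cvg i : cvg (m i n @[n --> \oo]).
  apply: nondecreasing_is_cvgn; last first.
    by exists 1 => _ [n _ <-]; exact: bigmin_le_id.
  apply/nondecreasing_seqP => n; apply: le_bigmin => [|j _]; first exact: bigmin_le_id.
  rewrite -colF colS; apply: stochastic_mulmx_ge => // k; rewrite colF.
  exact: bigmin_le.
pose a i := lim (m i n @[n --> \oo]).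
have cvgF j i : fprod Y s n j i @[n --> \oo] --> a i.
  have sum_cvg : (m i n + osc (col i (fprod Y s n))) @[n --> \oo] --> a i.
    by rewrite -[a i]addr0; apply: cvgD.
  apply: squeeze_cvgr (m_cvg i) sum_cvg; apply: nearW => n.
  rewrite bigmin_le /= -lerBlDr; apply: le_bigmin => [|k _].
    by rewrite lerBlDr ler_wpDr ?osc_ge0.
  by rewrite lerBlDr -lerBlDl -!colF le_osc.
exists a; split.
- move=> i; apply: cvgr_to_ge (cvgF (Ordinal r0) i) _.
  by apply: nearW => n; exact: (sF n).1.
- have : (\sum_i fprod Y s n (Ordinal r0) i) @[n --> \oo] --> \sum_i a i.
    by apply: cvgr_sum => i; exact: cvgF.
  under eq_fun do rewrite (sF _).2.
  by move=> h; exact: (cvg_unique (@norm_hausdorff _ R) h (cvg_cst _)).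
move=> j i; rewrite -(cvg_shiftn s) /=.
under eq_fun do rewrite addnC Phi_fprod.
by have := cvgF j i; rewrite -cvg_shiftS.
Qed.

End Consensus.

(** * The backward recursion of the limit weights *)

Lemma alpha_limit_weights (R : realType) (r : nat) (Y : nat -> 'M[R]_r) (s : nat) :
  (exists a, is_limit_weights Y s a) -> is_limit_weights Y s (alpha Y s).
Proof. exact: (@xgetPex _ (fun=> 0) [set a | is_limit_weights Y s a]). Qed.

(** Pass to the limit in [Phi Y t s = Phi Y t s.+1 *m Y s]. The diagonal entry may stand for its
    whole column, all rows having the same limit. *)
Lemma alpha_mulmx (R : realType) (r : nat) (Y : nat -> 'M[R]_r) (s : nat) (i : 'I_r) :
  (forall s, exists a, is_limit_weights Y s a) ->
  alpha Y s i = \sum_l alpha Y s.+1 l * Y s l i.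
Proof.
move=> ex; have [_ _ ls] := alpha_limit_weights (ex s).
have [_ _ lS] := alpha_limit_weights (ex s.+1).
have : Phi Y t s i i @[t --> \oo] --> \sum_l alpha Y s.+1 l * Y s l i.
  (* The factorization is used for [s < t] only, hence the shift. *)
  rewrite -(cvg_shiftn s.+1) /=.
  have E n : Phi Y (n + s.+1) s = Phi Y (n + s.+1) s.+1 *m Y s.
    rewrite /Phi addnK (_ : (n + s.+1 - s)%N = n.+1); last by lia.
    by rewrite big_nat_recr //=; congr (_ *m Y _); lia.
  under eq_fun do rewrite E mxE.
  apply: cvgr_sum => l.
  apply: cvgM; last exact: cvg_cst.
  by have := lS i l; rewrite -(cvg_shiftn s.+1).
by move=> h; exact: (cvg_unique (@norm_hausdorff _ R) (ls i i) h).
Qed.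

(** * Counting nonfaulty and Byzantine nodes *)

Section Nodes.
Variables (r nb : nat).
Implicit Types A B : {set 'I_(r + nb)}.

Lemma card_nodes_le A : (#|A| <= r + nb)%N.
Proof. by rewrite -[leqRHS]card_ord max_card. Qed.

Lemma lshift_nonfaulty (i : 'I_r) : lshift nb i \in nonfaulty r nb.
Proof. exact: imset_f. Qed.

Lemma rshift_nonfaulty (i : 'I_nb) : rshift r i \in nonfaulty r nb = false.
Proof.
apply/negP => /imsetP[k _ /(congr1 val) /= h].
by have := ltn_ord k; rewrite -h ltnNge leq_addr.
Qed.

Lemma byzantineC : byzantine r nb = ~: nonfaulty r nb.
Proof.
apply/setP => i; rewrite inE; case: (split_ordP i) => k ->.
  rewrite lshift_nonfaulty; apply/negP => /imsetP[l _ /(congr1 val) /= h].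
  by have := ltn_ord k; rewrite h ltnNge leq_addr.
by rewrite rshift_nonfaulty imset_f.
Qed.

Lemma big_nonfaulty (T : Type) (idx : T) (op : Monoid.com_law idx) A
    (z : 'I_(r + nb) -> T) :
  \big[op/idx]_(i in A :&: nonfaulty r nb) z i =
  \big[op/idx]_(i : 'I_r | lshift nb i \in A) z (lshift nb i).
Proof.
rewrite big_split_ord /= [X in op _ X]big_pred0 ?Monoid.mulm1.
  by apply: eq_bigl => i; rewrite inE lshift_nonfaulty andbT.
by move=> i; rewrite inE rshift_nonfaulty andbF.
Qed.

Lemma card_nonfaulty A :
  #|A :&: nonfaulty r nb|%SET = #|[set i : 'I_r | lshift nb i \in A]%SET|.
Proof.
by rewrite -!sum1_card big_nonfaulty; apply: eq_bigl => i; rewrite inE.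
Qed.

Lemma card_nonfaulty_byzantine A :
  (#|A :&: nonfaulty r nb|%SET + #|A :&: byzantine r nb|%SET = #|A|)%N.
Proof. by rewrite byzantineC -finset.setDE cardsID. Qed.

Lemma card_byzantine_le A : (#|A :&: byzantine r nb|%SET <= nb)%N.
Proof.
apply: leq_trans (subset_leq_card (finset.subsetIr _ _)) _.
by apply: leq_trans (leq_imset_card _ _) _; rewrite card_ord.
Qed.

End Nodes.

(** * Reduced graphs that avoid prescribed edges *)

Lemma subset_card_between (T : finType) (A N : {set T}) b :
  A \subset N -> (#|A| <= b <= #|N|)%N ->
  exists B : {set T}, [/\ A \subset B, B \subset N & #|B| = b].
Proof.
move=> AN /andP[Ab bN].
have cND : #|N :\: A|%SET = (#|N| - #|A|)%N.
  by rewrite cardsD (finset.setIidPr AN).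
have : (0 < #|[set B : {set T} | B \subset N :\: A & #|B| == b - #|A|]%SET|)%N.
  by rewrite cards_draws bin_gt0 cND leq_sub2r.
move=> /card_gt0P[B]; rewrite inE subsetD => /andP[/andP[BN BA] /eqP cB].
exists (A :|: B)%SET; split; rewrite ?finset.subsetUl ?finset.subUset ?AN //.
by rewrite cardsU finset.setIC (disjoint_setI0 BA) cards0 subn0 cB subnKC.
Qed.

Section ReducedGraphs.
Variables (r nb : nat) (e : rel 'I_(r + nb)) (b : nat).
Hypotheses (hb : (nb <= b)%N) (hdeg : forall j, (2 * b + 1 <= #|nbrs e j|)%N).

(** At each node the [b] removed edges are chosen to include all those coming from [A j]. There are
    enough edges to remove: of at least [2 * b + 1] neighbours at most [b] are Byzantine. *)
Lemma reduced_graph_avoiding (A : 'I_r -> {set 'I_r}) :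
  (forall j, (#|A j| <= b)%N) ->
  exists H, reduced_graph e b H /\
    forall u v, (u, v) \in H -> e (lshift nb u) (lshift nb v) && (u \notin A v).
Proof.
move=> hA; pose N j := [set i | (i, j) \in nonfaulty_edges e]%SET.
have cN j : (b <= #|N j|)%N.
  have -> : #|N j| = #|nbrs e (lshift nb j) :&: nonfaulty r nb|%SET.
    by rewrite card_nonfaulty; apply: eq_card => i; rewrite !inE.
  have := card_nonfaulty_byzantine (nbrs e (lshift nb j)).
  have := card_byzantine_le (nbrs e (lshift nb j)); have := hdeg (lshift nb j).
  by lia.
have ex j : exists B : {set 'I_r}, [/\ (A j :&: N j)%SET \subset B, B \subset N j & #|B| = b].
  apply: subset_card_between; first exact: finset.subsetIr.
  by rewrite cN andbT; apply: leq_trans (hA j); apply: subset_leq_card; exact: finset.subsetIl.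
have [B hB] := fin_all_exists ex.
exists [set p in nonfaulty_edges e | p.1 \notin B p.2]%SET; split.
  apply/andP; split; first by apply/fintype.subsetP => p; rewrite inE => /andP[].
  apply/forallP => j; have [_ BN <-] := hB j; apply/eqP/eq_card => i.
  rewrite !inE /=; have [iB|//] := boolP (i \in B j); last by rewrite andbT andNb.
  by have /(fintype.subsetP BN) := iB; rewrite !inE => ->.
move=> u v; rewrite !inE /= => /andP[uv uB]; rewrite uv /=.
apply: contra uB => uA; have [/fintype.subsetP AB _ _] := hB v.
by apply: AB; rewrite !inE uA.
Qed.

(** Any member of a source component of such a reduced graph serves as the root. *)
Lemma A4_root (A : 'I_r -> {set 'I_r}) : A4 e b -> (forall j, (#|A j| <= b)%N) ->
  exists i0, forall j,
    connect (fun u v => e (lshift nb u) (lshift nb v) && (u \notin A v)) i0 j.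
Proof.
move=> a4 /reduced_graph_avoiding[H [/a4[S [cS hS]] HA]].
have /card_gt0P[i0 iS] : (0 < #|S|)%N by lia.
exists i0 => j; apply: connect_sub (hS _ iS j) => u v /HA uv; exact: connect1.
Qed.

End ReducedGraphs.

(** * Rows of the mixing matrix: existence, stochasticity and lower bounds *)

Section Rows.
Variables (R : realType) (r nb : nat) (e : rel 'I_(r + nb)) (b : nat).
Variables (x : 'I_(r + nb) -> R) (j : 'I_r) (Sm Sp : {set 'I_(r + nb)}).
Hypotheses (he : irreflexive e) (hb : (nb <= b)%N).
Hypothesis hdeg : forall j, (2 * b + 1 <= #|nbrs e j|)%N.
Hypothesis trim : trimming e b x j Sm Sp.

Local Notation Nj := (nbrs e (lshift nb j)).
Local Notation D := (Dj e b j)%:R.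
Local Notation C := (kept e j Sm Sp).
Local Notation nf := (nonfaulty r nb).
Local Notation bz := (byzantine r nb).
Local Notation Cb := (C :&: bz)%SET.
Local Notation Cr := (C :&: nf)%SET.
Local Notation Smr := (Sm :&: nf)%SET.
Local Notation Spr := (Sp :&: nf)%SET.
Local Notation q := (b - #|Nj :&: bz|%SET + #|Cb|)%N.

Lemma trimming_card (X : {set 'I_(r + nb)}) :
  (#|Nj :&: X|%SET = #|Sm :&: X|%SET + #|Sp :&: X|%SET + #|C :&: X|%SET)%N.
Proof.
have [[SmN SpN] _ dS _ _] := trim.
rewrite -(cardsID (Sm :|: Sp) (Nj :&: X)); congr (_ + _)%N; last first.
  by rewrite /kept finset.setIDAC.
have I0 : #|(Sm :&: X) :&: (Sp :&: X)|%SET = 0%N.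
  apply: eq_card0 => i; rewrite !inE; apply/negP => /andP[/andP[im _] /andP[ip _]].
  by have := disjointFr dS im; rewrite ip.
rewrite -cardsUI I0 addn0.
apply: eq_card => i; rewrite !inE.
have := fintype.subsetP SmN i; have := fintype.subsetP SpN i; rewrite !inE.
case: (i \in Sm); case: (i \in Sp) => //= h1 h2; rewrite ?andbT ?andbF ?orbF ?orbb //.
all: by rewrite ?(h1 isT) ?(h2 isT).
Qed.

Lemma card_kept : (#|C| + 2 * b = #|Nj|)%N.
Proof.
have [_ [cm cp] _ _ _] := trim; have := trimming_card finset.setT.
by rewrite !finset.setIT cm cp; lia.
Qed.

Lemma kept_gt0 : (0 < #|C|)%N.
Proof. by have := card_kept; have := hdeg (lshift nb j); lia. Qed.

Lemma Dj_kept : Dj e b j = #|C|.+1.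
Proof. by rewrite /Dj -card_kept addnK addn1. Qed.

Lemma notin_nbrs : lshift nb j \in Nj = false.
Proof. by rewrite inE he. Qed.

Lemma Dj_le : (Dj e b j <= r + nb)%N.
Proof.
rewrite Dj_kept; have := max_card [in (lshift nb j |: C)%SET].
by rewrite card_ord cardsU1 finset.in_setD notin_nbrs andbF.
Qed.

(** A kept Byzantine neighbour is not trimmed, so each trimmed set has at most
    [#|Nj :&: bz| - #|Cb|] Byzantine nodes among its [b]. The truncated subtraction in [q] is exact
    because [nb <= b]. *)
Lemma card_trimmed_ge : (q <= #|Smr|)%N /\ (q <= #|Spr|)%N.
Proof.
have [_ [cm cp] _ _ _] := trim; have := trimming_card bz.
have := card_nonfaulty_byzantine Sm; have := card_nonfaulty_byzantine Sp.
have := card_byzantine_le Nj.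
by rewrite cm cp; lia.
Qed.

Lemma mean_over_le (A : {set 'I_(r + nb)}) M : (0 < #|A|)%N ->
  (forall i, i \in A -> x i <= M) -> mean_over x A <= M.
Proof.
move=> A0 h; rewrite /mean_over mulrC ler_pdivrMr ?ltr0n //.
by apply: le_trans (ler_sum _ h) _; rewrite sumr_const mulr_natr.
Qed.

Lemma mean_over_ge (A : {set 'I_(r + nb)}) M : (0 < #|A|)%N ->
  (forall i, i \in A -> M <= x i) -> M <= mean_over x A.
Proof.
move=> A0 h; rewrite /mean_over mulrC ler_pdivlMr ?ltr0n //.
by apply: le_trans _ (ler_sum _ h); rewrite sumr_const mulr_natr.
Qed.

(** A kept value lies above every value of [Sm] and below every value of [Sp], hence between the
    means over their nonfaulty parts; [theta] is the linear interpolation coefficient. *)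
Lemma normalized_row_exists : exists y, normalized_row e b x j Sm Sp y.
Proof.
have [q0|q0] := boolP (0 < q)%N; last first.
  by eexists; rewrite /normalized_row (negPf q0) => i; reflexivity.
have [qm qp] := card_trimmed_ge.
have m0 := leq_trans q0 qm; have p0 := leq_trans q0 qp.
have [[SmN SpN] _ dS hm hp] := trim.
set Mm := mean_over x Smr; set Mp := mean_over x Spr.
have CN i : i \in C -> [/\ i \in Nj, i \notin Sm & i \notin Sp].
  by rewrite !inE negb_or => /andP[/andP[-> ->] ->].
have lo i : i \in C -> Mm <= x i.
  move=> /CN[iN im ip]; apply: mean_over_le => // k /setIP[km _].
  by apply: hm => //; rewrite finset.in_setD im.
have up i : i \in C -> x i <= Mp.
  move=> /CN[iN im ip]; apply: mean_over_ge => // k /setIP[kp _].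
  by apply: hp => //; rewrite finset.in_setD ip.
pose theta i := (Mp - x i) / (Mp - Mm).
eexists; rewrite /normalized_row q0; exists theta.
split; last by move=> i; reflexivity.
move=> i iC; have l := lo _ iC; have u := up _ iC; rewrite -/Mm -/Mp.
have [E|NE] := eqVneq Mp Mm.
  (* When the two means coincide, division by zero makes [theta] vanish, and the kept value equals
     the common mean. *)
  rewrite /theta E subrr invr0 mulr0 lexx ler01 mul0r add0r subr0 mul1r.
  by split=> //; apply/eqP; rewrite eq_le l -E u.
have M0 : 0 < Mp - Mm by rewrite subr_gt0 lt_neqAle eq_sym NE (le_trans l u).
split; last by rewrite /theta; field; exact: lt0r_neq0.
rewrite /theta divr_ge0 ?subr_ge0 ?(le_trans l u) //=.
by rewrite ler_pdivrMr // mul1r lerD2l lerN2.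
Qed.

(** A bound valid for all rows: the better served trimmed side shares at least [1/4] (before
    division by [D]) among its nodes, and both their number and [D] are at most [r + nb]. *)
Definition row_min : R := (4 * (r + nb)%:R ^+ 2)^-1.

Lemma row_min_le (m : nat) : (0 < m <= r + nb)%N -> row_min <= (4 * m%:R * D)^-1.
Proof.
move=> /andP[m0 mn]; have D0 : (0 < Dj e b j)%N by rewrite Dj_kept.
have n0 : (0 < r + nb)%N := leq_trans m0 mn.
rewrite /row_min lef_pV2 ?posrE ?mulr_gt0 ?exprn_gt0 ?ltr0n //.
by rewrite -mulrA ler_wpM2l // expr2 ler_pM // ler_nat ?Dj_le.
Qed.

(* The last clause: if 0 < q, one of the two trimmed sides receives at least half
   of the redistributed weight, so that only the other side, which has at most b
   nonfaulty nodes, can be missing from the reduced graph. *)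
Lemma normalized_row_weights (y : 'I_r -> R) : normalized_row e b x j Sm Sp y ->
  exists c um up : R,
  [/\ forall i, y i = (i == j)%:R * D^-1 + (lshift nb i \in C)%:R * c
        + (lshift nb i \in Sm)%:R * um + (lshift nb i \in Sp)%:R * up,
      [/\ (2 * D)^-1 <= c, 0 <= um & 0 <= up],
      D^-1 + c * #|Cr|%:R + um * #|Smr|%:R + up * #|Spr|%:R = 1,
      D^-1 * x (lshift nb j) + c * (\sum_(i in Cr) x i)
        + um * (\sum_(i in Smr) x i) + up * (\sum_(i in Spr) x i) =
        trimmed_mean e b x j Sm Sp
    & [\/ row_min <= um, row_min <= up | (#|Smr| + #|Spr| <= b)%N] ].
Proof.
have D0 : 0 < D :> R by rewrite ltr0n Dj_kept.
have DN : D != 0 :> R by exact: lt0r_neq0.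
have [qm qp] := card_trimmed_ge.
have [[SmN SpN] [cm cp] dS _ _] := trim.
have CN i : i \in C -> [/\ i \in Nj, i \notin Sm & i \notin Sp].
  by rewrite !inE negb_or => /andP[/andP[-> ->] ->].
have jC : lshift nb j \in C = false by rewrite finset.in_setD notin_nbrs andbF.
have jSm : lshift nb j \in Sm = false.
  by apply/negP => /(fintype.subsetP SmN); rewrite notin_nbrs.
have jSp : lshift nb j \in Sp = false.
  by apply/negP => /(fintype.subsetP SpN); rewrite notin_nbrs.
have DE : D = 1 + #|Cb|%:R + #|Cr|%:R :> R.
  by rewrite Dj_kept -(card_nonfaulty_byzantine C) -addn1 !natrD; ring.
have tmE : trimmed_mean e b x j Sm Sp =
    D^-1 * (x (lshift nb j) + \sum_(i in Cb) x i + \sum_(i in Cr) x i).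
  rewrite /trimmed_mean big_setU1 ?jC //= (big_setID nf) /= addrAC addrA.
  by rewrite byzantineC -finset.setDE.
rewrite /normalized_row; have [q0|q0] := boolP (0 < q)%N; last first.
  move=> hy; have Cb0 : Cb = finset.set0.
    by apply/eqP; rewrite -cards_eq0; move: q0; lia.
  exists D^-1, 0, 0; split.
  - move=> i; rewrite hy !mulr0 !addr0.
    have [->|_] := eqVneq i j; first by rewrite jC mul0r addr0 mul1r.
    by rewrite mul0r add0r /=; case: ifP; rewrite ?mul1r ?mul0r.
  - by split=> //; rewrite lef_pV2 ?posrE ?mulr_gt0 // ler_peMl ?ler1n // ltW.
  - have -> : #|Cr|%:R = D - 1 :> R by rewrite DE Cb0 cards0; ring.
    by field.
  - by rewrite tmE Cb0 big_set0 !mul0r !addr0 mulrDr.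
  (* Here at least [b] neighbours are Byzantine and all of them are trimmed, which leaves at most
     [b] nonfaulty nodes among the [2 * b] trimmed ones. *)
  - apply: Or33; have := card_nonfaulty_byzantine Sm; have := card_nonfaulty_byzantine Sp.
    have := trimming_card bz; move: q0; rewrite Cb0 cards0 cm cp; lia.
case=> theta [htheta hy].
set Dr : R := D in D0 DN DE tmE hy *.
have m0 : (0 < #|Smr|)%N := leq_trans q0 qm.
have p0 : (0 < #|Spr|)%N := leq_trans q0 qp.
set sm : R := #|Smr|%:R; set sp : R := #|Spr|%:R.
have sm0 : 0 < sm by rewrite ltr0n.
have sp0 : 0 < sp by rewrite ltr0n.
have smN := lt0r_neq0 sm0; have spN := lt0r_neq0 sp0.
set cb : R := #|Cb|%:R in DE; set cr : R := #|Cr|%:R in DE.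
set Mm := mean_over x Smr in htheta; set Mp := mean_over x Spr in htheta.
pose Tb := \sum_(i in Cb) theta i; pose Tr := \sum_(i in Cr) theta i.
have inC i (A : {set 'I_(r + nb)}) : i \in (C :&: A)%SET -> i \in C by move=> /setIP[].
have Tb0 : 0 <= Tb by apply: sumr_ge0 => i /inC/htheta[/andP[]].
have Tr0 : 0 <= Tr by apply: sumr_ge0 => i /inC/htheta[/andP[]].
have compl (A : {set 'I_(r + nb)}) :
    \sum_(i in A) (1 - theta i) = #|A|%:R - \sum_(i in A) theta i.
  by rewrite sumrB sumr_const.
have Tb1 : 0 <= cb - Tb.
  by rewrite -compl; apply: sumr_ge0 => i /inC/htheta[/andP[_]]; rewrite subr_ge0.
have Tr1 : 0 <= cr - Tr.
  by rewrite -compl; apply: sumr_ge0 => i /inC/htheta[/andP[_]]; rewrite subr_ge0.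
have sumx (A : {set 'I_(r + nb)}) : \sum_(i in C :&: A) x i =
    (\sum_(i in C :&: A) theta i) * Mm + (#|C :&: A|%SET%:R - \sum_(i in C :&: A) theta i) * Mp.
  rewrite -compl !mulr_suml -big_split /=.
  by apply: eq_bigr => i /inC/htheta[].
have sumSm : \sum_(i in Smr) x i = sm * Mm by rewrite /Mm /mean_over mulVKf.
have sumSp : \sum_(i in Spr) x i = sp * Mp by rewrite /Mp /mean_over mulVKf.
have wm : \sum_(i in Cb) theta i / (sm * Dr) + \sum_(i in Cr) theta i / (2 * sm * Dr) =
    (Tb + Tr / 2) / (sm * Dr).
  by rewrite -!mulr_suml -/Tb -/Tr; field; rewrite smN DN.
have wp : \sum_(i in Cb) (1 - theta i) / (sp * Dr)
    + \sum_(i in Cr) (1 - theta i) / (2 * sp * Dr) =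
    (cb - Tb + (cr - Tr) / 2) / (sp * Dr).
  by rewrite -!mulr_suml !compl -/Tb -/Tr; field; rewrite spN DN.
(* A kept Byzantine node gives away its whole weight and a kept nonfaulty node half of it; [theta]
   splits this between the two sides, each of which shares it equally. *)
exists (2 * Dr)^-1, ((Tb + Tr / 2) / (sm * Dr)), ((cb - Tb + (cr - Tr) / 2) / (sp * Dr)).
split.
- move=> i; rewrite hy -wm -wp.
  have [->|_] := eqVneq i j; first by rewrite jC jSm jSp !mul0r !addr0 mul1r.
  rewrite !(finset.in_setI _ _ nf) lshift_nonfaulty !andbT.
  case: ifP => [/CN[_ /negPf -> /negPf ->]|_]; first by rewrite !mul0r !addr0 add0r mul1r.
  case: ifP => [iSm|_]; first by rewrite (disjointFr dS iSm) !mul0r !addr0 !add0r mul1r.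
  by case: ifP => _; rewrite !mul0r !add0r ?mul1r.
- by split=> //; (apply: divr_ge0; [by rewrite addr_ge0 // divr_ge0 | by rewrite ltW // mulr_gt0]).
- rewrite -/cr -/sm -/sp; transitivity ((1 + cb + cr) / Dr); last by rewrite -DE divff.
  by field; rewrite smN spN DN.
- rewrite tmE sumSm sumSp !sumx -/Tb -/Tr -/cb -/cr.
  by field; rewrite smN spN DN.
have cbr : 1 <= cb + cr.
  by rewrite -natrD ler1n addnC card_nonfaulty_byzantine kept_gt0.
(* The shares of the two sides add up to [cb + cr / 2], which is at least [1/2], so one of them is
   at least [1/4]. *)
have [h|h] := lerP (4^-1) (Tb + Tr / 2).
  apply: Or31; apply: (le_trans (row_min_le (m := #|Smr|) _)).
    by rewrite m0 card_nodes_le.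
  by rewrite -mulrA invfM ler_wpM2r // invr_ge0 ltW // mulr_gt0.
apply: Or32; apply: (le_trans (row_min_le (m := #|Spr|) _)).
  by rewrite p0 card_nodes_le.
rewrite -mulrA invfM ler_wpM2r //.
  by move: cbr h Tr1 Tb1 Tb0 Tr0; clear; lra.
Qed.

Lemma sum_indicator (A : {set 'I_(r + nb)}) (w : R) (z : 'I_(r + nb) -> R) :
  \sum_(i < r) (lshift nb i \in A)%:R * w * z (lshift nb i) =
  w * \sum_(i in A :&: nf) z i.
Proof.
rewrite big_nonfaulty mulr_sumr [RHS]big_mkcond /=.
by apply: eq_bigr => i _; case: ifP; rewrite ?mul1r ?mul0r.
Qed.

Lemma normalized_row_sum (y : 'I_r -> R) : normalized_row e b x j Sm Sp y ->
  \sum_i y i = 1 /\ \sum_i y i * x (lshift nb i) = trimmed_mean e b x j Sm Sp.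
Proof.
case/normalized_row_weights => c [um [up [hy _ mass mean _]]].
(* Taken at [z = x] this gives the trimmed mean, and at the constant 1 the row sum. *)
have E (z : 'I_(r + nb) -> R) : \sum_i y i * z (lshift nb i) =
    D^-1 * z (lshift nb j) + c * (\sum_(i in Cr) z i)
        + um * (\sum_(i in Smr) z i) + up * (\sum_(i in Spr) z i).
  rewrite -!sum_indicator.
  have -> : D^-1 * z (lshift nb j) = \sum_i (i == j)%:R * D^-1 * z (lshift nb i).
    rewrite (bigD1 j) //= eqxx mul1r big1 ?addr0 // => i /negPf ->.
    by rewrite !mul0r.
  by rewrite -!big_split; apply: eq_bigr => i _; rewrite hy !mulrDl.
split; last by rewrite E mean.
rewrite -mass; under eq_bigr do rewrite -[y _]mulr1.
by rewrite (E (fun=> 1)) !sumr_const mulr1.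
Qed.

(** [A] holds the nonfaulty neighbours whose weight may be too small: those of one trimmed side when
    the other side is well served, or those of both sides when they number at most [b] in all. This
    is the input of [A4_root]. *)
Lemma normalized_row_ge (y : 'I_r -> R) : normalized_row e b x j Sm Sp y ->
  [/\ forall i, 0 <= y i, row_min <= y j
    & exists A : {set 'I_r}, (#|A| <= b)%N /\
      forall i, e (lshift nb i) (lshift nb j) -> i \notin A -> row_min <= y i].
Proof.
case/normalized_row_weights => c [um [up [hy [c_ge um0 up0] _ _ pos]]].
have n0 : (0 < r + nb)%N by have := ltn_ord (lshift nb j); lia.
have D0 : 0 < D :> R by rewrite ltr0n Dj_kept.
have rD : row_min <= (2 * D)^-1.
  apply: le_trans (row_min_le (m := 1) _) _; first by [].
  by rewrite mulr1 lef_pV2 ?posrE ?mulr_gt0 // ler_wpM2r ?ler_nat // ltW.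
have D2 : (2 * D)^-1 <= D^-1 :> R.
  by rewrite lef_pV2 ?posrE ?mulr_gt0 // ler_peMl ?ler1n // ltW.
have r0 : 0 <= row_min by rewrite invr_ge0 mulr_ge0 ?exprn_ge0.
have c0 : 0 <= c by rewrite (le_trans r0) ?(le_trans rD).
have term (B : bool) (w : R) : 0 <= w -> 0 <= B%:R * w by move=> w0; rewrite mulr_ge0.
have tD i := term (i == j) _ (le_trans r0 (le_trans rD D2)).
have tC i := term (lshift nb i \in C) _ c0.
have tm i := term (lshift nb i \in Sm) _ um0.
have tp i := term (lshift nb i \in Sp) _ up0.
have [_ [cm cp] _ _ _] := trim.
have y0 i : 0 <= y i by rewrite hy !addr_ge0.
split=> //.
  rewrite hy eqxx mul1r -!addrA ler_wpDr ?addr_ge0 //; exact: le_trans rD D2.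
have yC i : lshift nb i \in C -> row_min <= y i.
  move=> iC; have := tD i; have := tm i; have := tp i; rewrite hy iC mul1r.
  by have := le_trans rD c_ge; lra.
have ym i : row_min <= um -> lshift nb i \in Sm -> row_min <= y i.
  move=> h iC; have := tD i; have := tC i; have := tp i; rewrite hy iC mul1r.
  by lra.
have yp i : row_min <= up -> lshift nb i \in Sp -> row_min <= y i.
  move=> h iC; have := tD i; have := tC i; have := tm i; rewrite hy iC mul1r.
  by lra.
have split_nbr i : e (lshift nb i) (lshift nb j) ->
    [|| lshift nb i \in Sm, lshift nb i \in Sp | lshift nb i \in C].
  by rewrite !inE => ->; rewrite andbT; case: (_ \in Sm); case: (_ \in Sp).
have cA (S : {set 'I_(r + nb)}) : #|S| = b -> (#|S :&: nf|%SET <= b)%N.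
  by move=> <-; apply: subset_leq_card; exact: finset.subsetIl.
case: pos => [hm|hp|hc].
- exists [set i | lshift nb i \in Sp]%SET; rewrite -card_nonfaulty cA //; split=> // i.
  rewrite inE => /split_nbr /or3P[iS _|-> //|iC _]; [exact: ym | exact: yC].
- exists [set i | lshift nb i \in Sm]%SET; rewrite -card_nonfaulty cA //; split=> // i.
  rewrite inE => /split_nbr /or3P[-> //|iS _|iC _]; [exact: yp | exact: yC].
exists [set i | lshift nb i \in Sm :|: Sp]%SET; split; last first.
  move=> i ei; rewrite !inE negb_or => /andP[im ip]; apply: yC.
  by move: (split_nbr _ ei); rewrite (negPf im) (negPf ip).
rewrite -card_nonfaulty finset.setIUl; apply: leq_trans hc.
by rewrite -cardsUI leq_addr.
Qed.

End Rows.

(** * Consequences of (A4): the explicit bound and the mixing matrices *)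

Section Network.
Variables (r nb : nat) (e : rel 'I_(r + nb)) (b : nat).
Hypotheses (he : irreflexive e) (hb : (nb <= b)%N).
Hypothesis hdeg : forall j, (2 * b + 1 <= #|nbrs e j|)%N.
Hypothesis hA4 : A4 e b.

Lemma A4_gt0 : (0 < r)%N.
Proof.
have [|i0 _] := A4_root hb hdeg (A := fun=> finset.set0) hA4.
  by move=> j; rewrite cards0.
exact: leq_ltn_trans (leq0n _) (ltn_ord i0).
Qed.

Lemma nu_gt0 : (0 < nu e b)%N.
Proof.
have [|H [hH _]] := reduced_graph_avoiding hb hdeg (A := fun=> finset.set0).
  by move=> j; rewrite cards0.
rewrite /nu muln_gt0 A4_gt0 andbT; apply/card_gt0P; exists H.
by rewrite inE.
Qed.

Lemma mu_bounds (R : realType) : 0 < mu e b R < 1.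
Proof.
have B1 : (1 < 2 * Nmax e - 2 * b + 1)%N.
  have := hdeg (lshift nb (Ordinal A4_gt0)).
  have := leq_bigmax (F := fun j : 'I_r => #|nbrs e (lshift nb j)|) (Ordinal A4_gt0).
  by rewrite -/(Nmax e); lia.
have E1 : 1 < ((2 * Nmax e - 2 * b + 1)%N%:R ^+ nu e b : R).
  by rewrite exprn_egt1 ?ltr1n // -lt0n nu_gt0.
have E0 := lt_trans ltr01 E1.
by rewrite /mu subr_gt0 invf_lt1 // E1 /= ltrBlDr ltrDl invr_gt0.
Qed.

(** With [lam] the [nu]-th root of [mu], the convolution sum satisfies
    [S t.+1 = lam * S t + lam * rho t.+1], a contraction with delay 1 and vanishing error. *)
Lemma gap_bound_cvg0 (R : realType) (d : nat) (rho : nat -> R) (Cw L : R) :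
  (forall t, 0 <= rho t) -> rho t @[t --> \oo] --> (0 : R) ->
  gap_bound e b d rho Cw L t @[t --> \oo] --> (0 : R).
Proof.
move=> rho0 rho_cvg; have /andP[mu0 mu1] := mu_bounds R.
pose lam : R := mu e b R `^ ((nu e b)%:R^-1).
have lamE n : mu e b R `^ (n%:R / (nu e b)%:R) = lam ^+ n.
  by rewrite mulrC powRrM powR_mulrn // powR_ge0.
have lam0 : 0 <= lam by exact: powR_ge0.
have lam1 : lam < 1.
  rewrite ltNge; apply/negP => l1; have : 1 <= lam ^+ nu e b by exact: exprn_ege1.
  by rewrite -lamE divff ?pnatr_eq0 -?lt0n ?nu_gt0 // (powRr1 (ltW mu0)) leNgt mu1.
pose S t := \sum_(0 <= u < t.+1) rho u * lam ^+ (t - u + 1)%N.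
have S_cvg : S t @[t --> \oo] --> (0 : R).
  apply: (@cvg0_delayed_contraction _ S (fun t => lam * rho t.+1) lam 1) => //.
  - by rewrite lam0 lam1.
  - by move=> t; apply: sumr_ge0 => u _; rewrite mulr_ge0 ?exprn_ge0.
  - move=> t; rewrite addn1 {1}/S big_nat_recr //= subnn add0n expr1.
    rewrite [lam * rho _]mulrC lerD2r /S mulr_sumr le_eqVlt; apply/orP; left.
    apply/eqP; apply: eq_big_nat => u /andP[_ ut].
    by rewrite mulrCA -exprS subSn.
  rewrite -[X in _ --> X](mulr0 lam); apply: cvgM; first exact: cvg_cst.
  by rewrite (cvg_shiftS rho).
have lam_cvg : lam ^+ t @[t --> \oo] --> (0 : R).
  by apply: cvg_expr; rewrite ger0_norm.
have H : (Num.sqrt d%:R * r%:R * Cw * lam ^+ t + Num.sqrt d%:R * r%:R * L * S t)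
    @[t --> \oo] --> Num.sqrt d%:R * r%:R * Cw * 0 + Num.sqrt d%:R * r%:R * L * 0.
  by apply: cvgD; apply: cvgM => //; exact: cvg_cst.
rewrite !mulr0 addr0 in H; apply: cvg_trans H; apply: near_eq_cvg.
apply: nearW => t; rewrite /gap_bound lamE; congr (_ + _ * _).
by apply: eq_bigr => u _; rewrite lamE.
Qed.

(** For the root, (A4) is applied to the sets of neighbours that the rows may neglect; every edge of
    the resulting graph carries weight at least [row_min]. *)
Lemma normalized_matrix (R : realType) (x : 'I_(r + nb) -> R)
    (Sm Sp : 'I_r -> {set 'I_(r + nb)}) (P : 'M[R]_r) :
  (forall j, trimming e b x j (Sm j) (Sp j)) ->
  (forall j, normalized_row e b x j (Sm j) (Sp j) (P j)) ->
  [/\ stochastic P, rooted (row_min R r nb) P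
    & P *m (\col_j x (lshift nb j)) =
        \col_j trimmed_mean e b x j (Sm j) (Sp j)].
Proof.
move=> trim hP; have ge j := normalized_row_ge he hb hdeg (trim j) (hP j).
have sum j := normalized_row_sum he hb hdeg (trim j) (hP j).
split; last 1 first.
- apply/colP => j; rewrite !mxE -(sum j).2; apply: eq_bigr => i _.
  by rewrite mxE.
- by split=> [j i|j]; [case: (ge j) | case: (sum j)].
split=> [j|]; first by case: (ge j).
have ex j : exists A : {set 'I_r}, (#|A| <= b)%N /\ forall i,
    e (lshift nb i) (lshift nb j) -> i \notin A -> row_min R r nb <= P j i.
  by case: (ge j).
have [A hA] := fin_all_exists ex.
have [|i0 hi0] := A4_root hb hdeg (A := A) hA4; first by move=> j; case: (hA j).
exists i0 => j; apply: connect_sub (hi0 j) => u v /andP[uv uA]; apply: connect1.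
exact: (hA v).2.
Qed.

(** * Consensus along BRIDGE-T and the distance to [v] *)

Section Dynamics.
Variables (R : realType) (d : nat) (F : 'I_r -> 'rV[R]_d -> R) (rho : nat -> R).
Variables (L : R) (w : nat -> 'I_(r + nb) -> 'rV[R]_d).
Variables Sm Sp : nat -> 'I_r -> 'I_d -> {set 'I_(r + nb)}.
Hypotheses (hrho : step_sizes rho) (hw : bridge_t e b F rho w Sm Sp).
Hypothesis hL : forall j u k, `|grad (F j) u 0 k| <= L.

Local Notation entries k t := (\col_(j < r) w t (lshift nb j) 0 k).

Lemma row_min_gt0 : 0 < row_min R r nb.
Proof.
by rewrite invr_gt0 mulr_gt0 ?exprn_gt0 ?ltr0n // ltn_addr // A4_gt0.
Qed.

Lemma normalized_matrix_form (Y : 'I_d -> nat -> 'M[R]_r) :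
  (forall k t j,
    normalized_row e b (fun i => w t i 0 k) j (Sm t j k) (Sp t j k) (Y k t j)) ->
  [/\ forall k t, stochastic (Y k t), forall k t, rooted (row_min R r nb) (Y k t)
    & matrix_form F rho w Y].
Proof.
move=> hY; have nm k t :=
  normalized_matrix (fun j => (hw t j k).1) (fun j => hY k t j).
split=> k t; have [sY rY mY] := nm k t => //.
by rewrite mY; apply/colP => j; rewrite mxE (hw t j k).2 !mxE.
Qed.

(** The update is represented by matrices chosen through [normalized_row_exists], so the conclusion
    does not depend on the family from which [v] is built. *)
Lemma bridge_osc_cvg0 (k : 'I_d) : osc (entries k t) @[t --> \oo] --> (0 : R).
Proof.
have [rho_gt0 rho_dec rho_cvg _ _] := hrho.
have ex (q : 'I_d * nat) : exists P : 'M[R]_r, forall j,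
    normalized_row e b (fun i => w q.2 i 0 q.1) j (Sm q.2 j q.1) (Sp q.2 j q.1) (P j).
  have exj (j : 'I_r) := normalized_row_exists hb (hw q.2 j q.1).1.
  have [y hy] := fin_all_exists exj; exists (\matrix_(j, i) y j i) => j.
  by rewrite (_ : _ j = y j) //; apply/funext => i; rewrite mxE.
have [Y hY] := choice ex.
have [sY rY mY] := normalized_matrix_form (fun k t j => hY (k, t) j).
apply: (@osc_cvg0 R r (row_min R r nb) A4_gt0 row_min_gt0 (fun t => Y (k, t)) rho L _
  (fun t => \col_(j < r) grad (F j) (w t (lshift nb j)) 0 k)) => //.
- by move=> t; exact: ltW.
- by move=> t j; rewrite mxE.
Qed.

Variable Y : 'I_d -> nat -> 'M[R]_r.
Hypotheses (mY : matrix_form F rho w Y).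
Hypothesis limY : forall k s, exists a, is_limit_weights (Y k) s a.

(** By [alpha_mulmx], averaging [w t] with the weights at [t] equals averaging its image under
    [Y k t] with the weights at [t.+1]. Both sides thus change by the same gradient term at each
    step. *)
Lemma v_weighted_mean (t : nat) (k : 'I_d) :
  v F rho w Y t 0 k = \sum_i alpha (Y k) t i * w t (lshift nb i) 0 k.
Proof.
elim: t => [|t IH]; first by rewrite mxE big_geq // subr0.
have step : v F rho w Y t.+1 0 k = v F rho w Y t 0 k
    - rho t * \sum_i alpha (Y k) t.+1 i * grad (F i) (w t (lshift nb i)) 0 k.
  by rewrite !mxE big_nat_recr //= opprD addrA.
have wS i : w t.+1 (lshift nb i) 0 k = (\sum_l Y k t i l * w t (lshift nb l) 0 k)
    - rho t * grad (F i) (w t (lshift nb i)) 0 k.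
  have := mY k t; move/colP/(_ i); rewrite !mxE => ->; congr (_ - _).
  by apply: eq_bigr => l _; rewrite mxE.
rewrite step IH; under [RHS]eq_bigr do rewrite wS mulrBr.
rewrite sumrB mulr_sumr; congr (_ - _); last by apply: eq_bigr => i _; rewrite mulrCA.
under [RHS]eq_bigr do rewrite mulr_sumr.
rewrite exchange_big /=; apply: eq_bigr => l _.
by rewrite (alpha_mulmx _ _ (limY k)) mulr_suml; apply: eq_bigr => i _; rewrite mulrA.
Qed.

Lemma v_dist_le (t : nat) (j : 'I_r) (k : 'I_d) :
  `|(w t (lshift nb j) - v F rho w Y t) 0 k| <= osc (entries k t).
Proof.
have -> : (w t (lshift nb j) - v F rho w Y t) 0 k =
    \sum_i alpha (Y k) t i * (w t (lshift nb j) 0 k - w t (lshift nb i) 0 k).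
  under eq_bigr do rewrite mulrBr.
  have [_ a1 _] := alpha_limit_weights (limY k t).
  by rewrite sumrB -mulr_suml a1 mul1r -v_weighted_mean mxE mxE.
have [a0 a1 _] := alpha_limit_weights (limY k t).
rewrite -[leRHS]mul1r -a1 mulr_suml; apply: le_trans (ler_norm_sum _ _ _) _.
apply: ler_sum => i _; rewrite normrM ger0_norm // ler_wpM2l //.
have := le_osc (entries k t) i j; have := le_osc (entries k t) j i.
by rewrite !mxE ler_norml => h1 h2; apply/andP; split; lra.
Qed.

Lemma gap_cvg0 : gap F rho w Y t @[t --> \oo] --> (0 : R).
Proof.
have S_cvg : (\sum_(k < d) osc (entries k t) ^+ 2) @[t --> \oo] --> \sum_(k < d) (0 * 0 : R).
  apply: (@cvgr_sum R nat _ \oo) => k; under eq_fun do rewrite expr2.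
  by apply: cvgM; exact: bridge_osc_cvg0.
rewrite mul0r big1 // in S_cvg.
have H := cvg_comp _ _ S_cvg (@sqrt_continuous R 0).
rewrite sqrtr0 in H.
apply: squeeze_cvgr (cvg_cst 0) H; apply: nearW => t.
rewrite bigmax_ge_id /=; apply: bigmax_le => [|j _]; first exact: sqrtr_ge0.
apply: ler_wsqrtr; apply: ler_sum => k _; rewrite -real_normK ?num_real //.
by rewrite lerXn2r ?nnegrE ?osc_ge0 // v_dist_le.
Qed.

End Dynamics.
End Network.

(** * Gradient bounds, almost sure statements and the conclusion *)

Lemma normr_entry_le_enorm (R : realType) (d : nat) (u : 'rV[R]_d) (k : 'I_d) :
  `|u 0 k| <= enorm u.
Proof.
rewrite -sqrtr_sqr; apply: ler_wsqrtr; rewrite (bigD1 k) //= lerDl.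
by apply: sumr_ge0 => l _; exact: sqr_ge0.
Qed.

Lemma grad_local_loss_le (R : realType) (Z : Type) (d N : nat)
    (f : 'rV[R]_d -> Z -> R) (z : 'I_N -> Z) (L : R) (u : 'rV[R]_d) (k : 'I_d) :
  (0 < N)%N ->
  (forall n, differentiable (fun x => f x (z n)) u) ->
  (forall n, enorm (grad (fun x => f x (z n)) u) <= L) ->
  `|grad (local_loss f z) u 0 k| <= L.
Proof.
move=> N0 df fL; set dk : 'rV[R]_d := delta_mx 0 k.
have der n : derivable (fun x => f x (z n)) u dk by exact: diff_derivable.
have -> : local_loss f z = N%:R^-1 \*: \sum_(n < N) (fun x => f x (z n)).
  by apply/funext => x; rewrite /local_loss /= fct_sumE.
rewrite mxE deriveZ; last exact: derivable_sum.
rewrite derive_sum // normrZ ger0_norm ?invr_ge0 // ler_pdivrMl ?ltr0n //.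
apply: le_trans (ler_norm_sum _ _ _) _.
rewrite mulr_natl -[X in _ *+ X]card_ord -sumr_const; apply: ler_sum => n _.
by apply: le_trans (fL n); apply: le_trans _ (normr_entry_le_enorm _ k); rewrite mxE.
Qed.

(** The preimage under [X] of a [P2]-null set containing the failures of [Q] is [P1]-null, because
    [X] has law [P2]. *)
Lemma ae_pushforward (R : realType) (d1 d2 : measure_display)
    (T1 : measurableType d1) (T2 : measurableType d2)
    (P1 : probability T1 R) (P2 : probability T2 R) (X : {RV P1 >-> T2})
    (Q : T2 -> Prop) :
  (forall A, measurable A -> distribution P1 X A = P2 A) ->
  {ae P2, forall z, Q z} -> {ae P1, forall omega, Q (X omega)}.
Proof.
move=> hX [A [mA A0 QA]]; exists (X @^-1` A); split.
- by rewrite -[X in measurable X]setTI; exact: measurable_funP.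
- by have := hX A mA; rewrite A0.
- by move=> omega; exact: QA.
Qed.

Theorem theorem1 (R : realType)
  (r nb : nat) (e : rel 'I_(r + nb)) (b : nat)
  (he : irreflexive e) (hconn : weakly_connected e)
  (hb : (nb <= b)%N) (hdeg : forall j, (2 * b + 1 <= #|nbrs e j|)%N)
  (hA4 : A4 e b)
  (d : nat) (dZ : measure_display) (Z : measurableType dZ) (PZ : probability Z R)
  (f : 'rV[R]_d -> Z -> R) (hf : forall u z, 0 <= f u z)
  (L L' : R) (hA1 : A1 PZ f L L')
  (dO : measure_display) (Omega : measurableType dO) (PO : probability Omega R)
  (N : nat) (hN : (0 < N)%N)
  (zs : 'I_r -> 'I_N -> {RV PO >-> Z})
  (hzs : forall j n A, measurable A -> distribution PO (zs j n) A = PZ A)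
  (rho : nat -> R) (hrho : step_sizes rho) :
  {ae PO, forall omega : Omega,
    let F := fun j => local_loss f (fun n => zs j n omega) in
    forall (w : nat -> 'I_(r + nb) -> 'rV[R]_d)
      (Sm Sp : nat -> 'I_r -> 'I_d -> {set 'I_(r + nb)})
      (Y : 'I_d -> nat -> 'M[R]_r) (Cw : R),
    bridge_t e b F rho w Sm Sp ->
    mixing_matrices e b F rho w Sm Sp Y ->
    (forall (j : 'I_r) (k : 'I_d), `|w 0%N (lshift nb j) 0 k| <= Cw) ->
    [/\ gap F rho w Y t @[t --> \oo] --> (0 : R),
        cvg (gap_bound e b d rho Cw L t @[t --> \oo]),
        lim (gap F rho w Y t @[t --> \oo])
          <= lim (gap_bound e b d rho Cw L t @[t --> \oo])
      & lim (gap_bound e b d rho Cw L t @[t --> \oo]) = 0]}.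
Proof.
pose Q z := [/\ forall u, differentiable (fun x => f x z) u,
  forall u, enorm (grad (fun x => f x z) u) <= L
  & forall u1 u2, enorm (grad (fun x => f x z) u1 - grad (fun x => f x z) u2)
      <= L' * enorm (u1 - u2)].
(* There are finitely many samples, so almost surely (A1) holds at all of them together; the rest of
   the argument is deterministic for such an [omega]. *)
have aeQ : {ae PO, forall omega, forall j n, Q (zs j n omega)}.
  apply: filter_forall => j; apply: filter_forall => n.
  by apply: ae_pushforward (hzs j n) _; exact: hA1.
apply: filterS aeQ => omega HQ w Sm Sp Y Cw; set F := fun j => local_loss _ _ => hw hY _.
have [rho_gt0 _ rho_cvg _ _] := hrho.
have gF j u k : `|grad (F j) u 0 k| <= L.
  by apply: grad_local_loss_le => // n; have [df gf _] := HQ j n.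
have [mY limY] : matrix_form F rho w Y /\
    forall k s, exists a, is_limit_weights (Y k) s a.
  case: hY => [[_ mY limY]|nY]; first by split.
  have [sY rY mY] := normalized_matrix_form he hb hdeg hA4 hw nY.
  split=> // k s.
  exact: (limit_weights_exist (A4_gt0 hb hdeg hA4) (row_min_gt0 hb hdeg hA4 R)).
have gap0 := gap_cvg0 he hb hdeg hA4 hrho hw gF mY limY.
have bound0 := gap_bound_cvg0 hb hdeg hA4 d Cw L (fun t => ltW (rho_gt0 t)) rho_cvg.
have lim_gap := cvg_lim (@norm_hausdorff _ R) gap0.
have lim_bound := cvg_lim (@norm_hausdorff _ R) bound0.
split; [exact: gap0 | exact: cvgP bound0 | | exact: lim_bound].
(* Both limits have been computed separately, and the inequality reads [0 <= 0]. *)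
by rewrite lim_gap lim_bound.
Qed.
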